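(* Let $\mathcal G$ be a locally finite $\Gamma$-periodic graph without loops, with fundamental graph $\mathcal G_*=(\mathcal V_*,\mathcal A_* )$, let $V$ be a real $\Gamma$-periodic potential, and let $H(k)=A(k)-\varkappa+V$, $k\in\mathbb T^d$, be the fiber Schrödinger operator on $\ell^2(\mathcal V_* )$. Then for each $n\in\mathbb N$ $$\frac1{(2\pi)^d}\int_{\mathbb T^d}\operatorname{Tr}H^n(k)\,dk=\mathcal T_{n,0},\qquad \mathcal T_{n,0}=\sum_{\mathbf c\in\widetilde{\mathcal C}_n^0}\omega(\mathbf c).$$ In particular, with $v_x=V_x-\varkappa_x$, $$\frac1{(2\pi)^d}\int_{\mathbb T^d}\operatorname{Tr}H(k)\,dk=\mathcal T_{1,0}=\sum_{x\in\mathcal V_*}v_x,\qquad \frac1{(2\pi)^d}\int_{\mathbb T^d}\operatorname{Tr}H^2(k)\,dk=\mathcal T_{2,0}=\sum_{x\in\mathcal V_*}v_x^2+\mathcal N_2^0 .$$ If there are no multiple edges in the periodic graph $\mathcal G$, then $\mathcal N_2^0=\#\mathcal A_*$ in the last formula.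
   Context: Periodic graph. $\mathcal G=(\mathcal V,\mathcal E)$ is a connected infinite graph, possibly having multiple edges but (standing assumption) no loops, embedded into $\mathbb R^d$; $\mathcal V$ is its vertex set, $\mathcal E$ its set of unoriented edges. Each edge in $\mathcal E$ has two orientations, and $\mathcal A$ is the set of all oriented edges. An oriented edge starting at $x$ and ending at $y$ is denoted $(x,y)$ (several edges may have the same end points), and $\underline{\mathbf e}$ is the inverse of $\mathbf e$. The degree $\varkappa_x$ is the number of edges of $\mathcal A$ starting at $x$. $\Gamma\subset\mathbb R^d$ is a lattice of rank $d$ with basis $a_1,\dots,a_d$. The graph is locally finite and $\Gamma$-periodic: $\mathcal G+a=\mathcal G$ for all $a\in\Gamma$, and the quotient (fundamental) graph $\mathcal G_*=\mathcal G/\Gamma=(\mathcal V_*,\mathcal A_* )$ with $\mathcal V_*=\mathcal V/\Gamma$, $\mathcal A_*=\mathcal A/\Gamma$ is finite ($\mathcal G_*$ may have loops, with non-zero index). Edge index. Let $\Omega=\{\sum_s t_sa_s:\ t_s\in[0,1)\}$. Each $x\in\mathcal V$ is uniquely $x=x_0+[x]$ with $x_0\in\Omega$, $[x]\in\Gamma$; $[x]_{\mathbb A}\in\mathbb Z^d$ is the coordinate vector of $[x]$ in the basis $a_1,\dots,a_d$. For $\mathbf e=(x,y)\in\mathcal A$ put $\tau(\mathbf e)=[y]_{\mathbb A}-[x]_{\mathbb A}\in\mathbb Z^d$. This is $\Gamma$-invariant, so it induces the index $\tau(\mathbf e)$ for $\mathbf e\in\mathcal A_*$. Operators. $V$ is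 a real function on $\mathcal V$ with $V_{x+a}=V_x$ for $a\in\Gamma$; $V$ and $\varkappa$ are regarded also as functions (diagonal operators) on $\mathcal V_*$. With $\mathbb T^d=\mathbb R^d/(2\pi\mathbb Z)^d$: $(A(k)f)_x=\sum_{\mathbf e=(x,y)\in\mathcal A_*}e^{i\langle\tau(\mathbf e),k\rangle}f_y$ and $H(k)=A(k)-\varkappa+V$ on $\ell^2(\mathcal V_* )$. Cycles. A cycle of length $n\geq1$ in a graph is a sequence $\mathbf c=(\mathbf e_1,\dots,\mathbf e_n)$ of oriented edges $\mathbf e_j=(x_j,x_{j+1})$, $x_{n+1}=x_1$ (a closed walk; the starting point and direction matter, and backtracking is allowed); its index is $\tau(\mathbf c)=\sum_j\tau(\mathbf e_j)$. $\mathcal N_n^0$ is the number of cycles of length $n$ and index $0$ in $\mathcal G_*$. Modified graph. $\widetilde{\mathcal G}_*=(\mathcal V_*,\widetilde{\mathcal A}_* )$ is obtained by adding at each $x\in\mathcal V_*$ one loop $\mathbf e_x$ (a single element of $\widetilde{\mathcal A}_*$, its own inverse): $\widetilde{\mathcal A}_*=\mathcal A_*\cup\{\mathbf e_x\}_{x\in\mathcal V_*}$, $\tau(\mathbf e_x)=0$. $\widetilde{\mathcal C}_n^0$ is the set of cycles of length $n$ and index $0$ in $\widetilde{\mathcal G}_*$. Edge weights: $\omega(\mathbf e)=1$ for $\mathbf e\in\mathcal A_*$, $\omega(\mathbf e_x)=v_x:=V_x-\varkappa_x$; $\omega(\mathbf c)=\omega(\mathbf e_1)\cdots\omega(\mathbf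 e_n)$ for $\mathbf c=(\mathbf e_1,\dots,\mathbf e_n)$. *)

(* Defs.v *)
From HB Require Import structures.
From Stdlib Require Import Relation_Operators.
From mathcomp Require Import all_boot all_order all_algebra generic_quotient.
From mathcomp Require Import finmap.
From mathcomp Require Import all_classical all_reals all_analysis.
From mathcomp Require Import complex.
Set Implicit Arguments.
Unset Strict Implicit.
Unset Printing Implicit Defensive.
Import Order.TTheory GRing.Theory Num.Theory.
Import numFieldNormedType.Exports.

Local Open Scope quotient_scope.
Local Open Scope classical_set_scope.
Local Open Scope ring_scope.

Section Lattice.
Variables (R : realType) (d : nat).

(* The rows of [a] are the basis vectors a_1, ..., a_d. *)
Definition lattice_vec (a : 'M[R]_d) (z : 'rV[int]_d) : 'rV[R]_d :=
  map_mx intr z *m a.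

Definition lattice (a : 'M[R]_d) : set 'rV[R]_d :=
  [set g | exists z, g = lattice_vec a z].

Definition fundamental_cell (a : 'M[R]_d) : set 'rV[R]_d :=
  [set x | exists t : 'rV[R]_d, (forall s, 0 <= t 0 s < 1) /\ x = t *m a].

(* [x]_A : the unique z such that x - \sum_s z_s a_s lies in the fundamental
   cell; see [integer_partP] and [integer_part_uniq]. *)
Definition integer_part (a : 'M[R]_d) (x : 'rV[R]_d) : 'rV[int]_d :=
  xget 0 [set z | fundamental_cell a (x - lattice_vec a z)].

Lemma lattice0 a : lattice a 0.
Proof. by exists 0; rewrite /lattice_vec map_mx0 mul0mx. Qed.

Lemma latticeN a g : lattice a g -> lattice a (- g).
Proof. by move=> [z ->]; exists (- z); rewrite /lattice_vec map_mxN mulNmx. Qed.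

Lemma latticeD a g h : lattice a g -> lattice a h -> lattice a (g + h).
Proof.
by move=> [z ->] [w ->]; exists (z + w); rewrite /lattice_vec map_mxD mulmxDl.
Qed.

Lemma integer_part_uniq a x z : row_free a ->
  fundamental_cell a (x - lattice_vec a z) -> integer_part a x = z.
Proof.
move=> fa hz; apply: xget_unique => //= w [u [hu xu]].
case: hz => t [ht xt].
have E : map_mx intr w + u = map_mx intr z + t.
  apply: (row_free_inj fa); rewrite !mulmxDl -xu -xt /lattice_vec.
  by rewrite addrC subrK addrC subrK.
apply/rowP => s; move/rowP: E => /(_ s); rewrite !mxE => E.
have floorDt (m : int) (r : R) : 0 <= r < 1 -> Num.floor (m%:~R + r) = m.
  by move=> /andP[r0 r1]; apply: floor_def; rewrite intrD lerDl r0 ltrD2l.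
by rewrite -(floorDt (w 0 s) (u 0 s))// E floorDt.
Qed.

Lemma integer_partP a x : row_free a ->
  fundamental_cell a (x - lattice_vec a (integer_part a x)).
Proof.
move=> fa; have [t xE] : exists t, x = t *m a.
  by exists (x *m invmx a); rewrite mulmxKV// -row_free_unit.
pose z := \row_s Num.floor (t 0 s).
suff h : fundamental_cell a (x - lattice_vec a z).
  by rewrite (integer_part_uniq fa h).
exists (t - map_mx intr z); split=> [s|]; last by rewrite mulmxBl -xE.
rewrite !mxE subr_ge0 ltrBlDl floor_le/=.
by have := floorD1_gt (t 0 s); rewrite intrD.
Qed.

Lemma integer_part_shift a x z : row_free a ->
  integer_part a (x + lattice_vec a z) = integer_part a x + z.
Proof.
move=> fa; apply: integer_part_uniq => //.
rewrite /lattice_vec map_mxD mulmxDl opprD addrACA subrr addr0.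
exact: integer_partP.
Qed.

End Lattice.

(* A connected infinite multigraph with vertices in R^d, invariant under the
   lattice spanned by the rows of [basis].  Vertices are points of R^d; since
   several edges may join the same points, oriented edges form an abstract
   type on which the lattice acts ([translate] is only constrained on lattice
   vectors). *)
Record latticeGraph (R : realType) (d : nat) := LatticeGraph {
  basis : 'M[R]_d;
  basis_free : row_free basis;
  vertex : set 'rV[R]_d;
  edge : choiceType;
  src : edge -> vertex;
  tgt : edge -> vertex;
  inv : edge -> edge;
  translate : 'rV[R]_d -> edge -> edge;
  inv_involutive : involutive inv;
  inv_neq : forall e, inv e <> e;
  src_inv : forall e, src (inv e) = tgt e;
  vertex_translate : forall g x, lattice basis g -> vertex x -> vertex (x + g);
  translate0 : forall e, translate 0 e = e;
  translateD : forall g h e, lattice basis g -> lattice basis h ->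
    translate (g + h) e = translate g (translate h e);
  src_translate : forall g e, lattice basis g ->
    val (src (translate g e)) = val (src e) + g;
  tgt_translate : forall g e, lattice basis g ->
    val (tgt (translate g e)) = val (tgt e) + g;
  inv_translate : forall g e, lattice basis g ->
    inv (translate g e) = translate g (inv e);
  vertex_infinite : infinite_set vertex;
  edge_connected : forall x y : vertex,
    clos_refl_trans _ (fun u v => exists e, src e = u /\ tgt e = v) x y;
  locally_finite : forall x : vertex, finite_set [set e | src e = x] }.

Section Quotient.
Variables (R : realType) (d : nat) (G : latticeGraph R d).

Definition vertex_eqv : rel (vertex G) :=
  fun x y => `[< exists2 g, lattice (basis G) g & val y = val x + g >].

Definition edge_eqv : rel (edge G) :=
  fun e f => `[< exists2 g, lattice (basis G) g & f = translate g e >].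

Lemma vertex_eqv_equiv : equiv_class_of vertex_eqv.
Proof.
have sym x y : vertex_eqv x y -> vertex_eqv y x.
  move=> /asboolP[g hg xy]; apply/asboolP; exists (- g); first exact: latticeN.
  by rewrite xy addrK.
split=> [x|x y|y x z].
- by apply/asboolP; exists 0; [exact: lattice0|rewrite addr0].
- by apply/idP/idP; exact: sym.
- move=> /asboolP[g hg xy] /asboolP[h hh yz]; apply/asboolP; exists (g + h).
    exact: latticeD.
  by rewrite yz xy addrA.
Qed.

Lemma edge_eqv_equiv : equiv_class_of edge_eqv.
Proof.
have sym e f : edge_eqv e f -> edge_eqv f e.
  move=> /asboolP[g hg ->]; apply/asboolP; exists (- g); first exact: latticeN.
  by rewrite -translateD ?addNr ?translate0//; exact: latticeN.
split=> [e|e f|f e k].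
- by apply/asboolP; exists 0; [exact: lattice0|rewrite translate0].
- by apply/idP/idP; exact: sym.
- move=> /asboolP[g hg ->] /asboolP[h hh ->]; apply/asboolP; exists (h + g).
    exact: latticeD.
  by rewrite translateD.
Qed.

Canonical vertex_equiv := EquivRelPack vertex_eqv_equiv.
Canonical edge_equiv := EquivRelPack edge_eqv_equiv.

Definition vertex_quot := {eq_quot vertex_equiv}.
Definition edge_quot := {eq_quot edge_equiv}.

HB.instance Definition _ := Choice.on vertex_quot.
HB.instance Definition _ := EqQuotient.on vertex_quot.
HB.instance Definition _ := Choice.on edge_quot.
HB.instance Definition _ := EqQuotient.on edge_quot.

End Quotient.

Record periodicGraph (R : realType) (d : nat) := PeriodicGraph {
  lattice_graph :> latticeGraph R d;
  vertex_quot_finite : finite_set [set: vertex_quot lattice_graph];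
  edge_quot_finite : finite_set [set: edge_quot lattice_graph] }.

Section FiniteInstance.
Variables (T : choiceType) (fT : finite_set [set: T]).

Let s : seq T := fset_set [set: T].

Lemma enum_setT_mem x : x \in s.
Proof. by rewrite in_fset_set//= in_setT. Qed.

Lemma enum_setT_pickleK : pcancel (index^~ s) (onth s).
Proof.
move=> x; rewrite (onthE s) (nth_map x) ?index_mem ?enum_setT_mem//.
by rewrite nth_index ?enum_setT_mem.
Qed.

Lemma enum_setT_axiom : Finite.axiom s.
Proof. by move=> x; rewrite count_uniq_mem ?fset_uniq// enum_setT_mem. Qed.

End FiniteInstance.

Section FundamentalGraphCarriers.
Variables (R : realType) (d : nat) (G : periodicGraph R d).

Definition vertex_star := vertex_quot G.
Definition edge_star := edge_quot G.

HB.instance Definition _ := Choice.on vertex_star.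
HB.instance Definition _ := EqQuotient.on vertex_star.
HB.instance Definition _ := Choice_isCountable.Build vertex_star
  (enum_setT_pickleK (vertex_quot_finite G)).
HB.instance Definition _ := fintype.isFinite.Build vertex_star
  (enum_setT_axiom (vertex_quot_finite G)).

HB.instance Definition _ := Choice.on edge_star.
HB.instance Definition _ := EqQuotient.on edge_star.
HB.instance Definition _ := Choice_isCountable.Build edge_star
  (enum_setT_pickleK (edge_quot_finite G)).
HB.instance Definition _ := fintype.isFinite.Build edge_star
  (enum_setT_axiom (edge_quot_finite G)).

End FundamentalGraphCarriers.

Section PeriodicGraphNotions.
Variables (R : realType) (d : nat) (G : periodicGraph R d).

Definition loopless := forall e : edge G, src e <> tgt e.

Definition no_multiple_edges :=
  forall e f : edge G, src e = src f -> tgt e = tgt f -> e = f.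

Definition degree (x : vertex G) : nat :=
  #|` fset_set [set e : edge G | src e = x] |.

Definition edge_index (e : edge G) : 'rV[int]_d :=
  integer_part (basis G) (val (tgt e)) - integer_part (basis G) (val (src e)).

Lemma edge_index_translate g e : lattice (basis G) g ->
  edge_index (translate g e) = edge_index e.
Proof.
move=> gG; rewrite /edge_index src_translate// tgt_translate//.
case: gG => z ->; rewrite !integer_part_shift ?basis_free//.
by rewrite opprD addrACA subrr addr0.
Qed.

Definition periodic_potential (V : vertex G -> R) :=
  forall g (x y : vertex G), lattice (basis G) g -> val y = val x + g ->
    V y = V x.

End PeriodicGraphNotions.

Record indexedGraph (d : nat) := IndexedGraph {
  ivertex : finType;
  iedge : finType;
  isrc : iedge -> ivertex;
  itgt : iedge -> ivertex;
  iindex : iedge -> 'rV[int]_d }.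

Section IndexedGraph.
Variables (d : nat) (K : indexedGraph d).

(* path.cycle also relates the last edge to the first one.  The definition
   matches closed walks only for 0 < n. *)
Definition cycles0 (n : nat) : {set n.-tuple (iedge K)} :=
  [set c : n.-tuple (iedge K) |
    cycle (fun e f => itgt e == isrc f) c && (\sum_(e <- c) iindex e == 0)].

(* Each added loop is a single oriented edge, not a pair of orientations. *)
Definition add_loops : indexedGraph d := {|
  ivertex := ivertex K;
  iedge := (iedge K + ivertex K)%type;
  isrc := fun e => match e with inl f => isrc f | inr x => x end;
  itgt := fun e => match e with inl f => itgt f | inr x => x end;
  iindex := fun e => match e with inl f => iindex f | inr _ => 0 end |}.

End IndexedGraph.

Section FundamentalGraph.
Variables (R : realType) (d : nat) (G : periodicGraph R d).

(* Independent of the chosen representatives: see [edge_index_translate],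
   [pi_src_translate] and [pi_tgt_translate]. *)
Definition fundamental_graph : indexedGraph d := {|
  ivertex := vertex_star G;
  iedge := edge_star G;
  isrc := fun e => \pi_(vertex_star G) (src (repr e));
  itgt := fun e => \pi_(vertex_star G) (tgt (repr e));
  iindex := fun e => edge_index (repr e) |}.

Definition modified_graph : indexedGraph d := add_loops fundamental_graph.

Definition num_cycles0 (n : nat) : nat := #|cycles0 fundamental_graph n|.

Lemma pi_src_translate g (e : edge G) : lattice (basis G) g ->
  \pi_(vertex_star G) (src (translate g e)) = \pi_(vertex_star G) (src e).
Proof.
move=> gG; apply/esym/eqmodP/asboolP; exists g => //.
exact: src_translate.
Qed.

Lemma pi_tgt_translate g (e : edge G) : lattice (basis G) g ->
  \pi_(vertex_star G) (tgt (translate g e)) = \pi_(vertex_star G) (tgt e).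
Proof.
move=> gG; apply/esym/eqmodP/asboolP; exists g => //.
exact: tgt_translate.
Qed.

Variable V : vertex G -> R.

Definition loop_weight (x : vertex_star G) : R :=
  V (repr x) - (degree (repr x))%:R.

Definition edge_weight (e : iedge modified_graph) : R :=
  match e with inl _ => 1 | inr x => loop_weight x end.

Definition cycle_weight (c : seq (iedge modified_graph)) : R :=
  \prod_(e <- c) edge_weight e.

Definition trace_coef0 (n : nat) : R :=
  \sum_(c in cycles0 modified_graph n) cycle_weight c.

End FundamentalGraph.

Lemma sigma_finite_product d1 d2 (T1 : measurableType d1)
    (T2 : measurableType d2) (R : realType)
    (m1 : {sigma_finite_measure set T1 -> \bar R})
    (m2 : {sigma_finite_measure set T2 -> \bar R}) :
  sigma_finite setT (m1 \x m2)%E.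
Proof.
have /sigma_finiteP[F [TF ndF Foo]] := sigma_finiteT m1.
have /sigma_finiteP[G [TG ndG Goo]] := sigma_finiteT m2.
exists (fun n => F n `*` G n).
  rewrite -setXTT TF TG predeqE => -[x y]; split.
    move=> [/= [n _ Fnx] [k _ Gky]]; exists (maxn n k) => //; split.
    - by move: x Fnx; exact/subsetPset/ndF/leq_maxl.
    - by move: y Gky; exact/subsetPset/ndG/leq_maxr.
  by move=> [n _ []/= ? ?]; split; exists n.
move=> k; have [? ?] := Foo k; have [? ?] := Goo k.
split; first exact: measurableX.
by rewrite product_measure1E// lte_mul_pinfty// ge0_fin_numE.
Qed.

Section LebesgueTuple.
Variable R : realType.

Notation mR := (measurableTypeR R).

Definition cons_pair (d : nat) (p : (mR * d.-tuple mR)%type) : d.+1.-tuple mR :=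
  [tuple of p.1 :: p.2].

Lemma measurable_cons_pair d : measurable_fun setT (@cons_pair d).
Proof. exact: measurable_cons. Qed.

Lemma sigma_finite_cons_pair d
    (m : set (mR * d.-tuple mR)%type -> \bar R) : sigma_finite setT m ->
  sigma_finite setT (pushforward m (@cons_pair d)).
Proof.
move=> [F TF Foo].
pose u (t : d.+1.-tuple mR) : (mR * d.-tuple mR)%type := (thead t, [tuple of behead t]).
have uK p : u (cons_pair p) = p.
  by case: p => x t; rewrite /u /cons_pair theadE; congr pair; exact: val_inj.
have mu : measurable_fun setT u.
  apply/measurable_fun_pairP; split; last exact: measurable_behead.
  exact: measurable_tnth.
exists (fun i => u @^-1` F i).
  by rewrite -preimage_bigcup -TF preimage_setT.
move=> i; have [mF Fi] := Foo i; split; first by rewrite -[X in measurable X]setTI; exact: mu.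
rewrite /pushforward (_ : _ @^-1` _ = F i)//.
by apply/seteqP; split=> p /=; rewrite uK.
Qed.

Section Step.
Variables (d : nat) (m : {sigma_finite_measure set (d.-tuple mR) -> \bar R}).

Definition lebesgue_cons : set (d.+1.-tuple mR) -> \bar R :=
  pushforward (@lebesgue_measure R \x m)%E (@cons_pair d).

Let pushed : {measure set (d.+1.-tuple mR) -> \bar R} :=
  measure_function_pushforward__canonical__measure_function_Measure
    (@lebesgue_measure R \x m)%E (@measurable_cons_pair d).

Let lebesgue_cons0 : lebesgue_cons set0 = 0%E.
Proof. exact: (measure0 pushed). Qed.

Let lebesgue_cons_ge0 A : (0 <= lebesgue_cons A)%E.
Proof. exact: (measure_ge0 pushed). Qed.

Let lebesgue_cons_sigma_additive : semi_sigma_additive lebesgue_cons.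
Proof. exact: (@measure_semi_sigma_additive _ _ _ pushed). Qed.

HB.instance Definition _ := isMeasure.Build _ _ _ lebesgue_cons
  lebesgue_cons0 lebesgue_cons_ge0 lebesgue_cons_sigma_additive.

Let lebesgue_cons_sigma_finite : sigma_finite setT lebesgue_cons.
Proof.
exact: sigma_finite_cons_pair (sigma_finite_product _ _).
Qed.

HB.instance Definition _ := Measure_isSigmaFinite.Build _ _ _ lebesgue_cons
  lebesgue_cons_sigma_finite.

End Step.

(* Dirac mass at the only point when d = 0, then the product of the
   one-dimensional measure with the d-dimensional one, carried over to
   (d+1)-tuples. *)
Fixpoint lebesgue_tuple (d : nat) :
    {sigma_finite_measure set (d.-tuple mR) -> \bar R} :=
  match d with
  | 0 => \d_([tuple] : 0.-tuple mR)
  | d'.+1 => lebesgue_cons (lebesgue_tuple d')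
  end.

(* [0, 2 pi]^d stands for the torus R^d / (2 pi Z)^d. *)
Definition torus (d : nat) : set (d.-tuple mR) :=
  [set k | forall s, 0 <= tnth k s <= 2 * pi].

Definition torus_integral (d : nat) (f : d.-tuple R -> R[i]) : R[i] :=
  ((\int[lebesgue_tuple d]_(k in @torus d) complex.Re (f k)) +i*
   (\int[lebesgue_tuple d]_(k in @torus d) complex.Im (f k)))%C.

End LebesgueTuple.

(* [T] is meant to be linear; its matrix is taken in the standard basis. *)
Definition op_matrix (C : nzRingType) (X : finType)
    (T : {ffun X -> C} -> {ffun X -> C}) : 'M[C]_#|X| :=
  \matrix_(i, j) T [ffun x => (x == enum_val j)%:R] (enum_val i).

Definition op_trace (C : nzRingType) (X : finType)
    (T : {ffun X -> C} -> {ffun X -> C}) : C := \tr (op_matrix T).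

Section FiberOperator.
Local Open Scope complex_scope.
Variables (R : realType) (d : nat).

Definition expi (t : R) : R[i] := cos t +i* sin t.

Definition pairing (z : 'rV[int]_d) (k : d.-tuple R) : R :=
  \sum_(s < d) (z 0 s)%:~R * tnth k s.

Variables (G : periodicGraph R d) (V : vertex G -> R).

Notation l2 := {ffun vertex_star G -> R[i]}.

Definition fiber_adjacency (k : d.-tuple R) (f : l2) : l2 :=
  [ffun x => \sum_(e : iedge (fundamental_graph G) | isrc e == x)
     expi (pairing (iindex e) k) * f (itgt e)].

Definition fiber_schrodinger (k : d.-tuple R) (f : l2) : l2 :=
  [ffun x => fiber_adjacency k f x - (degree (repr x))%:R * f x
     + (V (repr x))%:C * f x].

Definition fiber_trace (n : nat) (k : d.-tuple R) : R[i] :=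
  op_trace (iter n (fiber_schrodinger k)).

End FiberOperator.

(* Main.v *)
(* H(k) is a weighted adjacency operator of the modified graph: an edge e carries
   the weight omega(e) exp(i <tau(e), k>), the diagonal part V - kappa being
   carried by the added loops.  Hence Tr H(k)^n is the sum of
   omega(c) exp(i <tau(c), k>) over all closed walks c of length n, and
   integrating over the torus annihilates the terms with tau(c) <> 0.

   Without loops in the periodic graph, a loop of the fundamental graph has
   non-zero index, so every cycle of length 2 and index 0 consists of two added
   loops or of two edges of the fundamental graph.  Without multiple edges, the
   only edge that closes e to a cycle of length 2 and index 0 is the inverse of
   e. *)
Require Import Defs.
From mathcomp Require Import all_boot all_order all_algebra generic_quotient.
From mathcomp Require Import all_classical all_reals all_analysis.
From mathcomp Require Import measurable_realfun complex ring.
Import Order.TTheory GRing.Theory Num.Theory.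
Import numFieldNormedType.Exports.

Local Open Scope ring_scope.
Local Open Scope complex_scope.

(** Frequencies are integers of either sign, so periodicity is wanted for negative multiples of the
    period too. *)
Lemma periodicz {U V : zmodType} {f : U -> V} {T : U} (z : int) (a : U) :
  periodic f T -> f (a + T *~ z) = f a.
Proof.
move=> fT; case: z => n; first exact: periodicn.
by rewrite -(periodicn fT n.+1 (a + _)) NegzE mulrNz subrK.
Qed.

(** * Fourier integrals of cosines over the torus *)

Section TorusIntegral.
Local Open Scope classical_set_scope.
Variable R : realType.
Notation mR := (measurableTypeR R).

Lemma pi2_gt0 : 0 < 2 * pi :> R.
Proof. by rewrite mulr_gt0// pi_gt0. Qed.

Lemma lebesgue_measure_period :
  @lebesgue_measure R `[0, 2 * pi] = (2 * pi)%:E.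
Proof. by rewrite lebesgue_measure_itv/= lte_fin pi2_gt0 oppr0 adde0. Qed.

(** For [z != 0] the primitive [sin (z x + t) / z] has period 2 pi, hence equal values at both ends
    of the interval. *)
Lemma integral_cos_period (z : int) (t : R) :
  (\int[@lebesgue_measure R]_(x in `[0%R, (2 * pi)%R]) (cos (z%:~R * x + t))%:E
   = (2 * pi * cos t * (z == 0)%:R)%:E)%E.
Proof.
have [->|z0] := eqVneq z 0.
  under eq_integral do rewrite mul0r add0r.
  rewrite integral_cst//= lebesgue_measure_period.
  by rewrite -EFinM; congr EFin; rewrite mulr1 mulrC.
have zR0 : z%:~R != 0 :> R by rewrite intr_eq0.
pose F (x : R) := (z%:~R)^-1 * sin (z%:~R * x + t).
have dF (x : R) : is_derive x 1 F (cos (z%:~R * x + t)).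
  rewrite /F; apply: is_derive_eq.
  by rewrite !(scaler0, addr0, scaler1, mulr1, mul0r, scale0r) /GRing.scale/=; field.
have cF : continuous F.
  move=> x; apply: differentiable_continuous; apply/derivable1_diffP.
  by have [] := dF x.
rewrite (@continuous_FTC2 _ _ F) ?pi2_gt0//.
- rewrite -EFinB; congr EFin.
  (* The upper endpoint adds [z] whole periods to the argument of the sine. *)
  rewrite /F !mulr0 add0r mulr_natl mulrzl (addrC _ t).
  by rewrite (periodicz _ _ (@sinD2pi R)) subrr.
- apply/continuous_subspaceT => x; apply: continuous_comp; last exact: continuous_cos.
  by apply: cvgD; [apply: cvgM; [exact: cvg_cst|exact: cvg_id]|exact: cvg_cst].
- split=> [x _||]; first by have [] := dF x.
  + exact/cvg_at_right_filter/cF.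
  + exact/cvg_at_left_filter/cF.
- by move=> x _; rewrite derive1E; apply: derive_val.
Qed.

Lemma measurable_torus d : measurable (@torus R d).
Proof.
have -> : @torus R d =
    \bigcap_(s in [set: 'I_d]) ((fun k => tnth k s) @^-1` `[0, 2 * pi]).
  by apply/seteqP; split=> k /= h s; [move=> _|]; have := h s;
    rewrite /= in_itv//=; apply.
apply: fin_bigcap_measurable => // s _; rewrite -[X in measurable X]setTI.
by apply: measurable_tnth => //; exact: measurable_itv.
Qed.

Lemma measurable_pairing d (z : 'rV[int]_d) :
  measurable_fun setT (pairing z : d.-tuple mR -> mR).
Proof.
apply: measurable_sum => s; apply: measurable_funM => //.
exact: measurable_tnth.
Qed.

Lemma integrable_cos {d} {T : measurableType d}
    (mu : {measure set T -> \bar R}) (D : set T) (f : T -> R) :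
  measurable D -> (mu D < +oo)%E -> measurable_fun setT f ->
  mu.-integrable D (fun x => (cos (f x))%:E).
Proof.
move=> mD Doo mf; apply: measurable_bounded_integrable => //.
- apply: measurable_funTS.
  exact: (measurableT_comp (continuous_measurable_fun (@continuous_cos R))).
- exists 1; split; first exact: num_real.
  by move=> M M1 k _; apply: le_trans (ltW M1); exact: cos_max.
Qed.

Lemma measurable_pairingD d (z : 'rV[int]_d) (t : R) :
  measurable_fun setT (fun k : d.-tuple mR => pairing z k + t).
Proof. by apply: measurable_funD => //; exact: measurable_pairing. Qed.

Lemma measurable_cos_pairing d (z : 'rV[int]_d) (t : R) :
  measurable_fun setT
    (fun k : d.-tuple mR => (cos (pairing z k + t))%:E).
Proof.
apply/measurable_EFinP.
apply: (measurableT_comp (continuous_measurable_fun (@continuous_cos R))).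
exact: measurable_pairingD.
Qed.

Lemma cons_pair_torus d :
  @cons_pair R d @^-1` @torus R d.+1 = `[0, 2 * pi] `*` @torus R d.
Proof.
apply/seteqP; split=> -[x k] /=.
  move=> h; split=> [|s]; first by have := h ord0; rewrite /= in_itv/=.
  by have := h (lift ord0 s); rewrite tnthS.
rewrite in_itv/= => -[hx hk] s.
by case: (unliftP ord0 s) => [j ->|->]; [rewrite tnthS; exact: hk|].
Qed.


(** Fubini on a rectangle: extending the integrand by zero reduces to the full product, where the
    section over an [x] outside [D1] vanishes identically. *)
Lemma integral_prod_setX d1 d2 (T1 : measurableType d1) (T2 : measurableType d2)
    (m1 : {sigma_finite_measure set T1 -> \bar R})
    (m2 : {sigma_finite_measure set T2 -> \bar R})
    (D1 : set T1) (D2 : set T2) (f : T1 * T2 -> \bar R) :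
  measurable D1 -> measurable D2 ->
  (m1 \x m2)%E.-integrable (D1 `*` D2) f ->
  (\int[m1 \x m2]_(p in D1 `*` D2) f p =
   \int[m1]_(x in D1) \int[m2]_(y in D2) f (x, y))%E.
Proof.
move=> mD1 mD2 fint.
have mD : measurable (D1 `*` D2) by exact: measurableX.
rewrite integral_mkcond -integral12_prod_meas1; last first.
  by rewrite -(integrable_mkcond _ mD).
rewrite [RHS]integral_mkcond; apply: eq_integral => x _.
rewrite /fubini_F patchE; case: ifPn => [xD1|xD1].
  rewrite [RHS]integral_mkcond; apply: eq_integral => y _.
  by rewrite !patchE in_setX/= xD1.
by rewrite integral0_eq// => y _; rewrite patchE in_setX/= (negbTE xD1).
Qed.

Lemma lebesgue_tuple_torus d :
  lebesgue_tuple R d (@torus R d) = ((2 * pi) ^+ d)%:E.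
Proof.
elim: d => [|d ih] /=.
  by rewrite expr0 diracE mem_set// => -[].
rewrite /lebesgue_cons /pushforward cons_pair_torus.
rewrite product_measure1E//; last exact: measurable_torus.
rewrite exprS EFinM; congr (_ * _)%E; last exact: ih.
exact: lebesgue_measure_period.
Qed.

Lemma pairing_cons d (z : 'rV[int]_d.+1) (x : R) (k : d.-tuple R) :
  pairing z (cons_pair (x, k)) =
  (z 0 0)%:~R * x + pairing (\row_(j < d) z 0 (lift ord0 j)) k.
Proof.
rewrite /pairing big_ord_recl; congr (_ * _ + _).
by apply: eq_bigr => i _; rewrite mxE tnthS.
Qed.

Lemma row_eq0_recl d (z : 'rV[int]_d.+1) :
  (z == 0) = (z 0 0 == 0) && (\row_(j < d) z 0 (lift ord0 j) == 0).
Proof.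
apply/eqP/andP => [->|[/eqP z0 /eqP/rowP zl]].
  by rewrite mxE eqxx; split=> //; apply/eqP/rowP => j; rewrite !mxE.
apply/rowP => i; rewrite [RHS]mxE.
by case: (unliftP ord0 i) => [j ->|->//]; have := zl j; rewrite !mxE.
Qed.

(* The phase t makes the induction on d go through; it also yields the integral
   of the sine. *)
Lemma integral_torus_cos d (z : 'rV[int]_d) (t : R) :
  (\int[lebesgue_tuple R d]_(k in @torus R d) (cos (pairing z k + t))%:E
   = ((2 * pi) ^+ d * cos t * (z == 0)%:R)%:E)%E.
Proof.
elim: d z t => [|d ih] z t /=.
  rewrite integral_dirac//; [|exact: measurable_torus|]; last first.
    by apply: measurable_funTS; exact: measurable_cos_pairing.
  rewrite diracE mem_set; last by case.
  by rewrite mul1e /pairing big_ord0 add0r expr0 mul1r thinmx0 eqxx mulr1.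
pose f (k : d.+1.-tuple mR) := (cos (pairing z k + t))%:E.
pose mu := (@lebesgue_measure R \x lebesgue_tuple R d)%E.
have mc := @measurable_cons_pair R d.
have muoo : (mu (`[0%R, (2 * pi)%R] `*` @torus R d) < +oo)%E.
  (* The [mu]-measure of this rectangle is the measure of the (d+1)-dimensional torus, already
     computed. *)
  rewrite -cons_pair_torus.
  apply: (le_lt_trans _ (ltry ((2 * pi : R) ^+ d.+1))).
  by have /eqP := lebesgue_tuple_torus d.+1; rewrite eq_le => /andP[].
have fint : mu.-integrable (`[0%R, (2 * pi)%R] `*` @torus R d) (f \o @cons_pair R d).
  apply: integrable_cos => //.
    by apply: measurableX => //; exact: measurable_torus.
  exact: (measurableT_comp (measurable_pairingD d.+1 z t) mc).
(* The measure on (d+1)-tuples is the image of [mu] under [cons_pair]: change variables, then apply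
   Fubini. *)
rewrite [LHS](@integral_pushforward _ _ _ _ _ _ mc mu _ f)//; last first.
- exact: measurable_torus.
- by rewrite cons_pair_torus.
- exact: measurable_cos_pairing.
rewrite cons_pair_torus integral_prod_setX//; last exact: measurable_torus.
under eq_integral.
  move=> x _.
  under eq_integral.
    (* The term of the first coordinate joins the phase, so [ih] applies with phase
       [z 0 0 * x + t]. *)
    move=> k _; rewrite /f/= pairing_cons addrAC addrC.
    over.
  rewrite ih.
  over.
rewrite /=; set b := (_ == 0)%:R.
under eq_integral do rewrite mulrAC EFinM.
rewrite integralZl//; last first.
  apply: integrable_cos => //.
    by have := ltry (2 * pi : R); rewrite -lebesgue_measure_period.
  by apply: measurable_funD => //; apply: measurable_funM.
rewrite integral_cos_period -EFinM row_eq0_recl -mulnb natrM -/b; congr EFin.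
by rewrite exprS; ring.
Qed.

Lemma integrable_torus_cos d (z : 'rV[int]_d) (t : R) :
  (lebesgue_tuple R d).-integrable (@torus R d)
    (fun k => (cos (pairing z k + t))%:E).
Proof.
apply: integrable_cos; first exact: measurable_torus.
- by have := ltry ((2 * pi : R) ^+ d); rewrite -lebesgue_tuple_torus.
- exact: measurable_pairingD.
Qed.

End TorusIntegral.

(** * Weighted adjacency operators and sums over walks *)

Section TupleSums.
Variables (A : nmodType) (E : finType).

Lemma big_tuple0 (P : pred (0.-tuple E)) (F : 0.-tuple E -> A) :
  \sum_(c | P c) F c = if P [tuple] then F [tuple] else 0.
Proof.
rewrite big_mkcond (big_pred1 [tuple])//= => c.
by apply/esym/eqP; exact: tuple0.
Qed.

Lemma big_tuple_cons n (P : pred (n.+1.-tuple E)) (F : n.+1.-tuple E -> A) :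
  \sum_(c | P c) F c =
  \sum_e \sum_(c : n.-tuple E | P [tuple of e :: c]) F [tuple of e :: c].
Proof.
rewrite pair_big_dep/= (reindex (fun p : E * n.-tuple E => [tuple of p.1 :: p.2]))//=.
exists (fun c => (thead c, [tuple of behead c])) => [[e c] _|c _].
  by rewrite theadE; congr pair; exact: val_inj.
by rewrite [RHS]tuple_eta.
Qed.

End TupleSums.

Section TransferOperator.
Variables (C : comNzRingType) (X E : finType) (s t : E -> X) (w : E -> C).

(** The weighted adjacency operator of a multigraph with edge set [E], sources [s] and targets
    [t]. *)
Definition transfer (f : {ffun X -> C}) : {ffun X -> C} :=
  [ffun x => \sum_(e | s e == x) w e * f (t e)].

Fixpoint walk_from (x : X) (c : seq E) : bool :=
  if c is e :: c' then (s e == x) && walk_from (t e) c' else true.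

(** Each application prepends one edge, so the n-th power runs over walks of n edges and evaluates
    [f] at their end. *)
Lemma iter_transferE n f x : iter n transfer f x =
  \sum_(c : n.-tuple E | walk_from x c)
    (\prod_(e <- c) w e) * f (last x (map t c)).
Proof.
elim: n x => [|n ih] x; first by rewrite big_tuple0/= big_nil mul1r.
rewrite iterS ffunE big_tuple_cons big_mkcond/=; apply: eq_bigr => e _.
case: eqVneq => [sx|_] /=; last by rewrite big_pred0.
rewrite ih big_distrr/=; apply: eq_bigr => c _.
by rewrite big_cons mulrA.
Qed.

(** [cycle] on [e :: c] unfolds to such a path with [e0 = e]; keeping [e0] separate lets the
    induction move [e]. *)
Lemma path_rcons_walk e c e0 :
  path (fun e f => t e == s f) e (rcons c e0) =
  walk_from (t e) c && (last (t e) (map t c) == s e0).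
Proof. by elim: c e => [|f c ih] e /=; rewrite ?andbT// ih andbA eq_sym. Qed.

Lemma op_traceE (T : {ffun X -> C} -> {ffun X -> C}) :
  op_trace T = \sum_x T [ffun y => (y == x)%:R] x.
Proof.
rewrite /op_trace /mxtrace.
under eq_bigr do rewrite mxE.
by rewrite [RHS](reindex _ (onW_bij _ (@enum_val_bij X))).
Qed.

(** The delta function at a vertex selects the walks that return to it. Length 0 is excluded: the
    identity has trace [#|X|], while there is only one empty tuple. *)
Lemma op_trace_iter_transfer n : (0 < n)%N ->
  op_trace (iter n transfer) =
  \sum_(c : n.-tuple E | cycle (fun e f => t e == s f) c) \prod_(e <- c) w e.
Proof.
case: n => // n _; rewrite op_traceE.
under eq_bigr do rewrite iter_transferE big_tuple_cons.
rewrite exchange_big big_tuple_cons/=; apply: eq_bigr => e _.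
(* The first edge fixes the starting vertex, so only [s e] survives in the sum over vertices. *)
rewrite (bigD1 (s e))//= [X in _ + X]big1 ?addr0; last first.
  by move=> x xe; rewrite big_pred0// => c; rewrite eq_sym (negbTE xe).
rewrite eqxx/= big_mkcond [RHS]big_mkcond; apply: eq_bigr => c _.
rewrite path_rcons_walk ffunE.
by case: walk_from; case: eqP => //=; rewrite ?mulr1 ?mulr0.
Qed.

End TransferOperator.

(** * Multiplicativity of the phases *)

Section TrigonometricSums.
Variables (R : realType).

Lemma expi0 : expi (0 : R) = 1.
Proof. by rewrite /expi cos0 sin0. Qed.

Lemma expiD (a b : R) : expi (a + b) = expi a * expi b.
Proof. by rewrite /expi cosD sinD; congr (_ +i* _); rewrite addrC. Qed.

Variables (d : nat) (k : d.-tuple R).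

Lemma pairing0 : pairing 0 k = 0.
Proof. by rewrite /pairing big1// => s _; rewrite mxE mul0r. Qed.

Lemma pairingD y z : pairing (y + z) k = pairing y k + pairing z k.
Proof.
by rewrite /pairing -big_split; apply: eq_bigr => s _; rewrite mxE intrD mulrDl.
Qed.

(** [expi] turns sums into products, so the phase of a walk depends only on its total index. *)
Lemma prod_weight_expi {E : Type} (w : E -> R) (z : E -> 'rV[int]_d) (c : seq E) :
  \prod_(e <- c) ((w e)%:C * expi (pairing (z e) k)) =
  (\prod_(e <- c) w e)%:C * expi (pairing (\sum_(e <- c) z e) k).
Proof.
elim: c => [|e c ih]; first by rewrite !big_nil pairing0 expi0 mulr1.
by rewrite !big_cons ih pairingD expiD rmorphM mulrACA.
Qed.

End TrigonometricSums.

(** * Edge classes and their representatives in the periodic graph *)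

Section VertexEdge.
Local Open Scope quotient_scope.
Variables (R : realType) (d : nat) (G : periodicGraph R d).
Local Notation K := (fundamental_graph G).

(** Data of an edge class are read at its canonical representative; with translation invariance this
    gives them at any edge of the class. *)
Lemma repr_pi_translate (e : edge G) :
  exists2 g, lattice (Defs.basis G) g & repr (\pi_(edge_star G) e) = translate g e.
Proof.
suff /eqmodP/asboolP[g gG eg] : e = repr (\pi_(edge_star G) e) %[mod edge_star G].
  by exists g.
by rewrite reprK.
Qed.

Lemma isrc_pi (e : edge G) :
  isrc (\pi_(edge_star G) e : iedge K) = \pi_(vertex_star G) (src e).
Proof.
rewrite /=; have [g gG ->] := repr_pi_translate e.
exact: pi_src_translate.
Qed.

Lemma itgt_pi (e : edge G) :
  itgt (\pi_(edge_star G) e : iedge K) = \pi_(vertex_star G) (tgt e).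
Proof.
rewrite /=; have [g gG ->] := repr_pi_translate e.
exact: pi_tgt_translate.
Qed.

Lemma iindex_pi (e : edge G) :
  iindex (\pi_(edge_star G) e : iedge K) = edge_index e.
Proof.
rewrite /=; have [g gG ->] := repr_pi_translate e.
exact: edge_index_translate.
Qed.

(** A lattice translation shifts the integer part by its own coordinates, so equal integer parts
    within one orbit force a zero shift. *)
Lemma vertex_eq (x y : vertex G) :
  \pi_(vertex_star G) x = \pi_(vertex_star G) y ->
  integer_part (Defs.basis G) (val x) = integer_part (Defs.basis G) (val y) -> x = y.
Proof.
move=> /eqmodP/asboolP[_ [z ->] yx].
rewrite yx integer_part_shift; last exact: Defs.basis_free.
move=> /eqP; rewrite -subr_eq0 opprD addNKr oppr_eq0 => /eqP z0.
by apply: val_inj; rewrite yx z0 /lattice_vec map_mx0 mul0mx addr0.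
Qed.

(** Index 0 gives the endpoints of a representative equal integer parts; lying in one orbit, they
    would coincide. *)
Lemma loopless_index_neq0 (e : iedge K) : loopless G ->
  (itgt e == isrc e) && (iindex e == 0) = false.
Proof.
move=> noloop; apply/negP => /andP[/eqP te /eqP ie].
apply: (noloop (repr e)); apply/esym/vertex_eq; first exact: te.
exact/subr0_eq.
Qed.

Lemma edge_index_inv (e : edge G) : edge_index (Defs.inv e) = - edge_index e.
Proof.
(* The target of [inv e] is the source of [inv (inv e)], that is, of [e]. *)
by rewrite /edge_index src_inv -(src_inv (Defs.inv e)) inv_involutive opprB.
Qed.

(** Lift [f] to start where [repr e] ends. The lift ends in the orbit of the source of [repr e], and
    the opposite index fixes its integer part, so it ends at that source and has the endpoints of
    the inverse edge. *)
Lemma closing_edgeE (e f : iedge K) : no_multiple_edges G ->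
  [&& itgt e == isrc f, itgt f == isrc e & iindex e + iindex f == 0] =
  (f == \pi_(edge_star G) (Defs.inv (repr e))).
Proof.
move=> nomult; apply/idP/eqP => [/and3P[/eqP ef /eqP fe /eqP ief]|->].
  have /eqmodP/asboolP[g gG efg] := esym ef.
  have <- : translate g (repr f) = Defs.inv (repr e).
    apply: nomult.
      by apply: val_inj; rewrite src_translate// src_inv efg.
    have srcg : src (translate g (repr f)) = tgt (repr e).
      by apply: val_inj; rewrite src_translate.
    apply: vertex_eq.
      rewrite pi_tgt_translate// -(src_inv (Defs.inv (repr e))) inv_involutive.
      exact: fe.
    have ieg : edge_index (translate g (repr f)) = - edge_index (repr e).
      by rewrite edge_index_translate//; apply/eqP; rewrite -addr_eq0 addrC; apply/eqP.
    rewrite -(src_inv (Defs.inv (repr e))) inv_involutive.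
    move: ieg; rewrite /edge_index srcg opprB.
    exact: subIr.
  rewrite -[LHS]reprK; apply/eqmodP/asboolP.
  by exists g.
rewrite isrc_pi itgt_pi iindex_pi src_inv -(src_inv (Defs.inv (repr e))) inv_involutive.
by rewrite edge_index_inv !eqxx subrr eqxx.
Qed.

End VertexEdge.

(** * Constant terms of trigonometric sums *)

Section TorusTrigSum.
Variables (R : realType) (d : nat) (I : finType) (P : pred I).
Variables (w : I -> R) (z : I -> 'rV[int]_d).

Lemma Rintegral_torus_cos_sum (t : R) :
  \int[lebesgue_tuple R d]_(k in @torus R d)
     (\sum_(i | P i) w i * cos (pairing (z i) k + t))
  = (2 * pi) ^+ d * cos t * \sum_(i | P i && (z i == 0)) w i.
Proof.
have int_term (i : I) : (lebesgue_tuple R d).-integrable (@torus R d)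
    (fun k => (w i * cos (pairing (z i) k + t))%:E).
  under eq_fun do rewrite EFinM.
  apply: integrableZl; first exact: measurable_torus.
  exact: integrable_torus_cos.
rewrite /Rintegral; under eq_integral do rewrite -sumEFin.
rewrite (integral_sum (measurable_torus R d) int_term).
(* Both sides become [fine] of a finite sum of extended reals, to be compared term by term. *)
rewrite big_mkcondr mulr_sumr/= -[RHS]/(fine _%:E) -sumEFin; congr fine.
apply: eq_bigr => i Pi; under eq_integral do rewrite EFinM.
rewrite integralZl; [|exact: measurable_torus|exact: integrable_torus_cos].
rewrite integral_torus_cos -EFinM; congr EFin.
by case: eqP => _; rewrite ?mulr1 ?mulr0// mulrC.
Qed.

Lemma torus_integral_expi_sum :
  torus_integral (fun k => \sum_(i | P i) (w i)%:C * expi (pairing (z i) k))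
  = ((2 * pi) ^+ d * \sum_(i | P i && (z i == 0)) w i)%:C.
Proof.
rewrite /torus_integral; congr (_ +i* _).
- have := Rintegral_torus_cos_sum 0; rewrite cos0 mulr1 => <-.
  apply: eq_Rintegral => k _; rewrite raddf_sum; apply: eq_bigr => i _ /=.
  by rewrite mul0r subr0 addr0.
(* The phase -pi/2 turns the cosine into the sine, and cos (-pi/2) = 0 makes the imaginary part
   vanish. *)
- have := Rintegral_torus_cos_sum (- (pi / 2)).
  rewrite cosN cos_pihalf mulr0 mul0r => <-.
  apply: eq_Rintegral => k _; rewrite raddf_sum; apply: eq_bigr => i _ /=.
  by rewrite mul0r addr0 cosD cosN sinN cos_pihalf sin_pihalf mulr0 mulrN1 sub0r opprK.
Qed.

End TorusTrigSum.

(** * The trace formula for the fiber operators *)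

Section TraceFormula.
Variables (R : realType) (d : nat) (G : periodicGraph R d) (V : vertex G -> R).
Local Notation M := (modified_graph G).

Lemma fiber_schrodinger_transfer (k : d.-tuple R) :
  fiber_schrodinger V k =1
  transfer _ _ _ (@isrc d M) (@itgt d M)
    (fun e => (edge_weight V e)%:C * expi (pairing (iindex e) k)).
Proof.
move=> f; apply/ffunP => x; rewrite !ffunE big_sumType/=.
rewrite -addrA; congr (_ + _).
  by apply: eq_bigr => e _; rewrite mul1r.
(* A single added loop starts at [x]; its index is 0, so its phase is 1 and only its weight
   remains. *)
rewrite big_pred1_eq pairing0 expi0 mulr1 /loop_weight rmorphB rmorph_nat.
by rewrite mulrBl addrC.
Qed.

Lemma fiber_traceE n (k : d.-tuple R) : (0 < n)%N ->
  fiber_trace V n k =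
  \sum_(c : n.-tuple (iedge M) | cycle (fun e f => itgt e == isrc f) c)
    (cycle_weight V c)%:C * expi (pairing (\sum_(e <- c) iindex e) k).
Proof.
move=> n0; rewrite /fiber_trace.
rewrite (funext (fiber_schrodinger_transfer k)) op_trace_iter_transfer//.
by apply: eq_bigr => c _; rewrite prod_weight_expi.
Qed.

Lemma torus_integral_fiber_trace n : (0 < n)%N ->
  (1 / (2 * pi) ^+ d)%:C * torus_integral (fiber_trace V n)
  = (trace_coef0 V n)%:C.
Proof.
move=> n0; under [fiber_trace V n]funext do rewrite fiber_traceE//.
rewrite torus_integral_expi_sum -rmorphM mulrA mul1r mulVf ?mul1r; last first.
  by rewrite expf_neq0// gt_eqF ?pi2_gt0.
by rewrite /trace_coef0; congr (_%:C); apply: eq_bigl => c; rewrite inE.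
Qed.

End TraceFormula.

(** * Cycles of length one and two *)

Section ShortCycles.
Variables (A : nmodType) (d : nat) (K : indexedGraph d).

(** [cycle] relates the last edge to the first, so a single edge has to close up on itself. *)
Lemma big_cycles0_1 (F : 1.-tuple (iedge K) -> A) :
  \sum_(c in cycles0 K 1) F c =
  \sum_(e | (itgt e == isrc e) && (iindex e == 0)) F [tuple e].
Proof.
rewrite big_tuple_cons [RHS]big_mkcond; apply: eq_bigr => e _.
by rewrite big_tuple0 inE /= andbT big_seq1.
Qed.

Lemma big_cycles0_2 (F : 2.-tuple (iedge K) -> A) :
  \sum_(c in cycles0 K 2) F c =
  \sum_e \sum_(f | [&& itgt e == isrc f, itgt f == isrc e &
                       iindex e + iindex f == 0]) F [tuple e; f].
Proof.
rewrite big_tuple_cons; apply: eq_bigr => e _.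
rewrite big_tuple_cons [RHS]big_mkcond; apply: eq_bigr => f _.
by rewrite big_tuple0 inE /= andbT big_cons big_seq1 -andbA.
Qed.

End ShortCycles.

Section ShortCyclesPeriodic.
Variables (R : realType) (d : nat) (G : periodicGraph R d) (V : vertex G -> R).
Hypothesis G_loopless : loopless G.

Lemma trace_coef0_1 : trace_coef0 V 1 = \sum_x loop_weight V x.
Proof.
rewrite /trace_coef0 big_cycles0_1 big_sumType/=.
rewrite big_pred0 ?add0r; last by move=> e; exact: loopless_index_neq0.
rewrite (eq_bigl xpredT); last by move=> x; rewrite !eqxx.
by apply: eq_bigr => x _; rewrite /cycle_weight big_seq1.
Qed.

Lemma trace_coef0_2 : trace_coef0 V 2 =
  \sum_x loop_weight V x ^+ 2 + (num_cycles0 G 2)%:R.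
Proof.
rewrite /trace_coef0 big_cycles0_2 big_sumType/= addrC; congr (_ + _).
  apply: eq_bigr => x _; rewrite big_sumType/= big_pred0 ?add0r; last first.
    (* An added loop followed by an edge of the fundamental graph would make that edge a loop of
       index 0. *)
    move=> e; rewrite add0r eq_sym; apply/negP => /and3P[/eqP ex /eqP xe ie].
    by have := loopless_index_neq0 _ _ _ e G_loopless; rewrite /= xe -ex eqxx ie.
  (* Consecutive added loops sit at the same vertex, so the second repeats the first. *)
  rewrite (big_pred1 x); last first.
    by move=> y; rewrite /= eqxx andbT [x == y]eq_sym andbb.
  by rewrite /cycle_weight big_cons big_seq1 expr2.
rewrite /num_cycles0 -sum1_card big_cycles0_2 natr_sum.
apply: eq_bigr => e _; rewrite big_sumType/= [X in _ + X]big_pred0 ?addr0.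
  by rewrite natr_sum; apply: eq_bigr => f _; rewrite /cycle_weight big_cons big_seq1 mulr1.
move=> x; apply/negP => /and3P[/eqP ex /eqP xe ie].
by have := loopless_index_neq0 _ _ _ e G_loopless; rewrite /= ex -xe eqxx ie.
Qed.

Lemma num_cycles0_2 : no_multiple_edges G ->
  num_cycles0 G 2 = #|{: edge_star G}|.
Proof.
move=> nomult; rewrite /num_cycles0 -!sum1_card big_cycles0_2.
apply: eq_bigr => e _; under eq_bigl do rewrite closing_edgeE//.
by rewrite big_pred1_eq.
Qed.

End ShortCyclesPeriodic.

Theorem theorem2p5 (R : realType) (d : nat) (G : periodicGraph R d)
    (V : vertex G -> R) (G_loopless : loopless G)
    (V_periodic : periodic_potential V) :
  (forall n : nat, (0 < n)%N ->
     (1 / (2 * pi) ^+ d)%:C * torus_integral (fiber_trace V n)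
     = (trace_coef0 V n)%:C) /\
  ((1 / (2 * pi) ^+ d)%:C
     * torus_integral (fun k => op_trace (fiber_schrodinger V k))
     = (trace_coef0 V 1)%:C /\
   trace_coef0 V 1 = \sum_(x : vertex_star G) loop_weight V x) /\
  ((1 / (2 * pi) ^+ d)%:C * torus_integral (fiber_trace V 2)
     = (trace_coef0 V 2)%:C /\
   trace_coef0 V 2 =
     \sum_(x : vertex_star G) loop_weight V x ^+ 2 + (num_cycles0 G 2)%:R) /\
  (no_multiple_edges G -> num_cycles0 G 2 = #|{: edge_star G}|).
Proof.
split; first exact: torus_integral_fiber_trace.
split.
  split; last exact: trace_coef0_1.
  (* One iteration is the operator itself, so this trace is [fiber_trace V 1] by conversion. *)
  exact: (torus_integral_fiber_trace _ _ _ V 1).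
split; last exact: num_cycles0_2.
by split; [exact: torus_integral_fiber_trace|exact: trace_coef0_2].
Qed.
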